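(* For every $n$ and every $D \geq n^{1/6}$, there is an $n$-vertex digraph $G$ for which adding any set of $\Theta((n/D)^{6/5})$ (i.e., at most $c\,(n/D)^{6/5}$ for a suitable constant $c>0$) shortcut edges from $G^{\star}$ cannot reduce the diameter to below $D$. Consequently, $S(n,D)=\Omega((n/D)^{6/5})$ for $D\ge n^{1/6}$.
   Context: For a digraph $G$, $G^{\star}$ denotes its transitive closure: $(u,v)\in G^{\star}$ iff there is a directed path from $u$ to $v$ in $G$. A shortcut edge is an edge of $G^{\star}$. For $(u,v)\in G^{\star}$, $\mathrm{dist}_G(u,v)$ is the number of edges of a shortest directed $u$-$v$ path in $G$; the diameter of $G$ is $\max_{(u,v)\in G^{\star}}\mathrm{dist}_G(u,v)$. $S(n,D)$ denotes the smallest number such that every $n$-vertex digraph $G$ admits a set $H\subseteq G^{\star}$ with $|H|\le S(n,D)$ such that $G\cup H$ has diameter at most $D$.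
   Formalization: D is also required to satisfy D < n in the first claim and D < n-1 in the bound on S(n,D): an n-vertex digraph has diameter at most n-1, so the first claim fails for D ≥ n, and S(n,D) = 0 for D ≥ n-1 makes the Ω bound fail. *)

(* Defs.v *)
From mathcomp Require Import all_boot.
From mathcomp Require Import boolp.

Set Implicit Arguments.
Unset Strict Implicit.
Unset Printing Implicit Defensive.

(* If no natural number satisfies P, this is 0. *)
Definition least (P : pred nat) : nat :=
  if pselect (exists k, P k) is left h then ex_minn h else 0.

Lemma leastP (P : pred nat) : (exists k, P k) ->
  P (least P) /\ forall k, P k -> least P <= k.
Proof.
by rewrite /least; case: pselect => // h _; case: ex_minnP => m Pm le_m; split.
Qed.

(* A digraph on V is its set of ordered edges. Loops are allowed: they change
   neither reachability nor distances. *)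
Notation digraph V := {set V * V}.

Section Digraphs.
Variable V : finType.
Implicit Types (G H : digraph V) (u v : V).

Definition edge G : rel V := [rel u v | (u, v) \in G].

(* The path with no edge is allowed, so every (u, u) belongs to the closure;
   dist G u u = 0, so such pairs do not contribute to the diameter. *)
Definition tclosure G : digraph V := [set uv | connect (edge G) uv.1 uv.2].

(* k counts edges: the path visits u and then the k vertices of p. *)
Definition has_walk G u v (k : nat) : bool :=
  [exists p : k.-tuple V, path (edge G) u p && (last u p == v)].

Definition dist G u v : nat := least (has_walk G u v).

Definition diameter G : nat := \max_(uv in tclosure G) dist G uv.1 uv.2.

Lemma has_walkP G u v (p : seq V) :
  path (edge G) u p -> last u p = v -> has_walk G u v (size p).
Proof.
by move=> Gp pv; apply/existsP; exists (in_tuple p); rewrite /= Gp pv eqxx.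
Qed.

Lemma tclosureP G u v :
  reflect (exists k, has_walk G u v k) ((u, v) \in tclosure G).
Proof.
rewrite inE /=; apply: (iffP connectP) => [[p Gp ->]|[k]].
  by exists (size p); apply: has_walkP.
by case/existsP=> p /andP[Gp /eqP <-]; exists p.
Qed.

Lemma distP G u v : (u, v) \in tclosure G ->
  has_walk G u v (dist G u v) /\ forall k, has_walk G u v k -> dist G u v <= k.
Proof. by move/tclosureP; apply: leastP. Qed.

Lemma diameter_tclosure G : diameter (G :|: tclosure G) <= 1.
Proof.
apply/bigmax_leqP => -[u v] uvG /=.
have [_] := distP uvG; apply; apply: (@has_walkP _ u v [:: v]) => //=.
rewrite andbT /edge /= in_setU; apply/orP; right; rewrite inE /=.
move: uvG; rewrite inE /=; apply: connect_sub u v => x y.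
rewrite /edge /= in_setU => /orP[xy|]; first exact: connect1.
by rewrite inE.
Qed.

End Digraphs.

Definition shortcuts_suffice (n D s : nat) : bool :=
  [forall G : digraph 'I_n, exists H : digraph 'I_n,
    [&& H \subset tclosure G, #|H| <= s & diameter (G :|: H) <= D]].

(* S(n, D). By shortcuts_suffice_ex the minimum exists whenever D > 0. *)
Definition shortcut_number (n D : nat) : nat := least (shortcuts_suffice n D).

Lemma shortcuts_suffice_ex (n D : nat) :
  0 < D -> exists s, shortcuts_suffice n D s.
Proof.
move=> D_gt0; exists #|{: 'I_n * 'I_n}|; apply/forallP=> G.
apply/existsP; exists (tclosure G); rewrite subxx max_card /=.
exact: leq_trans (diameter_tclosure G) D_gt0.
Qed.

(* Main.v *)
(** Vertices are triples (t, x, y) arranged in layers t < mk, grouped into m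
    blocks of k consecutive layers. An edge goes from layer t to layer t + 1,
    keeping (x, y) inside a block and adding some (b, b^2), b < m, when a new
    block is entered. The m^6 "lines" p = (x0, y0, a) are the paths from the
    first to the last layer that always add (a, a^2). As (a, a^2) is extreme
    on the parabola, every walk in the closure between the ends of p stays on p.
    A shortcut between two blocks lies on at most one line and skips at most mk
    layers; a shortcut inside a block lies on at most m lines and skips at most
    k layers. So the layers that H skips, summed over all lines, number at most
    |H| mk: if |H| < m^6 / 2, some line keeps length about mk / 2. The bound
    D >= n^(1/6) is what allows k >= 1 in the choice m^5 ~ n / D, mk ~ D. *)

Require Import Defs.
From mathcomp Require Import all_boot all_order all_algebra.
From mathcomp Require Import boolp reals exp.
From mathcomp Require Import zify.

Set Implicit Arguments.
Unset Strict Implicit.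
Unset Printing Implicit Defensive.

(** * Reachability and transitive closures *)

Lemma path_tclosure (V : finType) (G : digraph V) (f : nat -> V) i :
  (forall j, j < i -> (f j, f j.+1) \in G) -> (f 0, f i) \in tclosure G.
Proof.
elim: i => [|i IHi] Gf; rewrite inE ?connect0 //=.
apply: connect_trans (connect1 (Gf i (ltnSn i))).
by have := IHi (fun j lt_ji => Gf j (ltnW lt_ji)); rewrite inE.
Qed.

Lemma tclosure_setU (V : finType) (G H : digraph V) :
  tclosure G \subset tclosure (G :|: H).
Proof.
apply/subsetP => -[u v]; rewrite !inE /=; apply: connect_sub => x y Gxy.
by apply: connect1; rewrite /edge /= inE; apply/orP; left.
Qed.

(** * The layered digraph and its convex potential *)

Section ParabolaGraph.

Variables n m k : nat.
Hypotheses (m_gt0 : 0 < m) (k_gt0 : 0 < k).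

(** A line starts at x < m^2, y < m^3 and adds (a, a^2), with a <= m - 1, at most m - 1 times;
    [width] and [height] leave just this room. *)
Let width := m ^ 2 + m.-1 ^ 2.
Let height := m ^ 3 + m.-1 ^ 3.
Hypothesis room : m * k * (width * height) <= n.+1.

Let width_gt0 : 0 < width. Proof. by rewrite addn_gt0 expn_gt0 m_gt0. Qed.
Let height_gt0 : 0 < height. Proof. by rewrite addn_gt0 expn_gt0 m_gt0. Qed.

Implicit Types u v : 'I_n.+1.

(** Mixed-radix digits. Indices from [m * k * (width * height)] on get layers [m * k] and beyond,
    which [on_line] excludes. *)
Definition layer v := v %/ height %/ width.
Definition abscissa v := v %/ height %% width.
Definition ordinate v := v %% height.
Definition block v := layer v %/ k.

Definition vertex t x y : 'I_n.+1 := inord ((t * width + x) * height + y).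

Lemma vertexK t x y : t < m * k -> x < width -> y < height ->
  [/\ layer (vertex t x y) = t, abscissa (vertex t x y) = x
    & ordinate (vertex t x y) = y].
Proof.
move=> t_lt x_lt y_lt; rewrite /layer /abscissa /ordinate /vertex inordK.
  rewrite divnMDl // modnMDl !(divn_small y_lt) addn0 divnMDl // modnMDl.
  by rewrite (divn_small x_lt) addn0 !modn_small.
apply: leq_trans room; apply: (@leq_trans ((t * width + x).+1 * height)).
  by rewrite mulSn addnC ltn_add2r.
rewrite mulnA leq_mul2r; apply/orP; right.
apply: (@leq_trans (t.+1 * width)); first by rewrite mulSn addnC ltn_add2r.
by rewrite leq_mul2r t_lt orbT.
Qed.

Definition parabola_graph : digraph 'I_n.+1 :=
  [set e | (layer e.2 == (layer e.1).+1) && [exists b : 'I_m,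
     (abscissa e.2 == abscissa e.1 + (k %| layer e.2) * b) &&
     (ordinate e.2 == ordinate e.1 + (k %| layer e.2) * b ^ 2)]].

(* y - 2 a x + a^2 T, with T the block number, never decreases along an edge,
   and is constant only along displacements of slope (a, a^2); the inequality
   is written without subtraction. *)
Definition convex_step a u v :=
  [/\ layer u <= layer v,
      ordinate u + a ^ 2 * block u + 2 * (a * abscissa v)
        <= ordinate v + a ^ 2 * block v + 2 * (a * abscissa u)
    & ordinate u + a ^ 2 * block u + 2 * (a * abscissa v)
        = ordinate v + a ^ 2 * block v + 2 * (a * abscissa u) ->
      abscissa v + a * block u = abscissa u + a * block v].

Lemma convex_step_refl a u : convex_step a u u.
Proof. by split. Qed.

Lemma convex_step_trans a u v w :
  convex_step a u v -> convex_step a v w -> convex_step a u w.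
Proof.
move=> [uv1 uv2 uv3] [vw1 vw2 vw3]; split; first exact: leq_trans vw1.
  by lia.
move=> e; have e1 := uv3 ltac:(lia); have e2 := vw3 ltac:(lia); lia.
Qed.

Lemma convex_step_edge a u v : (u, v) \in parabola_graph -> convex_step a u v.
Proof.
rewrite inE /= => /andP[/eqP luv /existsP[b /andP[/eqP xv /eqP yv]]].
have bv : block v = (k %| layer v) + block u by rewrite /block luv divnS.
rewrite /convex_step bv xv yv luv leqnSn; case: (k %| _); last first.
  by rewrite !mul0n !addn0 !add0n; split=> // e; lia.
(* On entering a block the potential grows by (a - b)^2, which vanishes only for b = a. *)
rewrite !mul1n; have [ab ab_eq] := nat_Cauchy a b.
split=> // [|e]; first by lia.
have /eqP-> : a == b :> nat by rewrite -ab_eq; apply/eqP; lia.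
by lia.
Qed.

Lemma convex_step_tclosure a u v :
  (u, v) \in tclosure parabola_graph -> convex_step a u v.
Proof.
rewrite inE /= => /connectP[p + ->]; elim: p u => [|w p IHp] u /=.
  by move=> _; exact: convex_step_refl.
by case/andP=> /(convex_step_edge a) uw /IHp; apply: convex_step_trans.
Qed.

(** * Lines and their vertices *)

Definition line := ('I_(m ^ 2) * 'I_(m ^ 3) * 'I_m)%type.

Definition on_line (p : line) v :=
  [&& layer v < m * k, abscissa v == p.1.1 + p.2 * block v
    & ordinate v == p.1.2 + p.2 ^ 2 * block v].

Definition line_vertex (p : line) t :=
  vertex t (p.1.1 + p.2 * (t %/ k)) (p.1.2 + p.2 ^ 2 * (t %/ k)).

Lemma line_vertexK p t : t < m * k ->
  [/\ layer (line_vertex p t) = t,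
      abscissa (line_vertex p t) = p.1.1 + p.2 * (t %/ k)
    & ordinate (line_vertex p t) = p.1.2 + p.2 ^ 2 * (t %/ k)].
Proof.
move=> t_lt; case: p => [[x y] a] /=.
have lT : t %/ k <= m.-1 by rewrite -ltnS prednK // ltn_divLR.
have la : a <= m.-1 by rewrite -ltnS prednK.
apply: vertexK => //=.
  by rewrite -addSn leq_add //; exact: leq_mul.
by rewrite -addSn leq_add //= (expnSr m.-1 2) leq_mul // leq_exp2r.
Qed.

Lemma on_line_vertex p t : t < m * k -> on_line p (line_vertex p t).
Proof.
move=> t_lt; have [lt xt yt] := line_vertexK p t_lt.
by rewrite /on_line /block lt xt yt t_lt !eqxx.
Qed.

Lemma line_tclosure p :
  (line_vertex p 0, line_vertex p (m * k).-1) \in tclosure parabola_graph.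
Proof.
have mk_gt0 : 0 < m * k by rewrite muln_gt0 m_gt0.
apply: path_tclosure => t lt_t.
have lt1 : t.+1 < m * k by lia.
have [l1 x1 y1] := line_vertexK p lt1.
have [l0 x0 y0] := line_vertexK p (ltnW lt1).
rewrite inE /= l1 x1 y1 l0 x0 y0 eqxx /=; apply/existsP; exists p.2.
by rewrite divnS //; apply/andP; split; apply/eqP; lia.
Qed.

(** * Layers skipped by shortcuts *)

Section Shortcuts.

Variable H : digraph 'I_n.+1.
Hypothesis HG : H \subset tclosure parabola_graph.

Let GH := parabola_graph :|: H.

Definition span (e : 'I_n.+1 * 'I_n.+1) := layer e.2 - layer e.1.

Definition used (p : line) (e : 'I_n.+1 * 'I_n.+1) :=
  on_line p e.1 && on_line p e.2.

Lemma convex_step_GH a u v : (u, v) \in GH -> convex_step a u v.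
Proof.
rewrite inE => /orP[|/(subsetP HG)]; first exact: convex_step_edge.
exact: convex_step_tclosure.
Qed.

Lemma convex_step_path a u q :
  path (edge GH) u q -> convex_step a u (last u q).
Proof.
elim: q u => [|w q IHq] u /=; first by move=> _; apply: convex_step_refl.
by case/andP=> /(convex_step_GH a) uw /IHq; apply: convex_step_trans.
Qed.

(** The potential equals y0 - 2 a x0 at every vertex of the line, so monotonicity forces this value
    at [v]. The equality case gives the abscissa, and the value then gives the ordinate. *)
Lemma on_line_between (p : line) u v w :
  convex_step p.2 u v -> convex_step p.2 v w ->
  on_line p u -> on_line p w -> on_line p v.
Proof.
move=> [l1 i1 t1] [l2 i2 _] /and3P[_ /eqP xu /eqP yu].
case/and3P=> lw /eqP xw /eqP yw.
rewrite /on_line (leq_ltn_trans l2 lw) /=.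
have aa : p.2 ^ 2 = p.2 * p.2 by rewrite mulnn.
have e : ordinate u + p.2 ^ 2 * block u + 2 * (p.2 * abscissa v)
        = ordinate v + p.2 ^ 2 * block v + 2 * (p.2 * abscissa u).
  by rewrite aa in i1 i2 yu yw *; rewrite xu yu xw yw in i1 i2 *; lia.
have xv : abscissa v = p.1.1 + p.2 * block v by have := t1 e; lia.
rewrite xv eqxx /=; apply/eqP.
by rewrite aa in yu e *; rewrite xu xv yu in e; lia.
Qed.

Lemma used_span_le e : \sum_(p | used p e) span e <= m * k.
Proof.
rewrite sum_nat_const.
have [H0|[p0 p0e]] := set_0Vmem [set p | used p e].
  have p0 : [pred p | used p e] =i pred0.
    by move=> p; have := in_set0 p; rewrite -H0 !inE.
  by rewrite (eq_card0 p0).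
case: e => u v in p0e *; rewrite /span /=.
have [lt_uv|le_vu] := ltnP (block u) (block v).
  (* Across blocks, the two abscissas determine the slope [a], and then one end determines the
     line. *)
  suff card1 : #|[pred p | used p (u, v)]| <= 1.
    apply: leq_trans (leq_mul card1 (leqnn _)) _; rewrite mul1n.
    move: p0e; rewrite inE => /andP[_ /and3P[lv _ _]] /=.
    exact: leq_trans (leq_subr _ _) (ltnW lv).
  apply/card_le1P => -[[x1 y1] a1]; rewrite inE => p1e [[x2 y2] a2].
  rewrite inE; apply/idP/eqP => [|[-> -> ->] //].
  case/andP=> /and3P[_ /eqP xu' /eqP yu'] /and3P[_ /eqP xv' _].
  case/andP: p1e => /and3P[_ /eqP xu /eqP yu] /and3P[_ /eqP xv _].
  rewrite /= in xu yu xv xu' yu' xv'.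
  have [d dE] : exists d, block v = block u + d.+1.
    by exists (block v - block u).-1; lia.
  have e : a1 * d.+1 = a2 * d.+1 by rewrite dE in xv xv'; lia.
  have {}e : a1 = a2 :> nat by apply/eqP; rewrite -(eqn_pmul2r (ltn0Sn d)) e.
  rewrite e in xu yu.
  by congr (_, _, _); apply: val_inj => //=; lia.
(* Within a block, one end and [a] determine the line, and the span is at most [k]. *)
suff cardm : #|[pred p | used p (u, v)]| <= m.
  apply: leq_mul => //; rewrite leq_subLR.
  rewrite (divn_eq (layer v) k) (divn_eq (layer u) k) -addnA leq_add //.
    by rewrite leq_mul2r le_vu orbT.
  by rewrite ltnW // ltn_addl // ltn_mod.
rewrite -[X in _ <= X]card_ord -(@card_in_imset _ _ (fun p : line => p.2)).
  exact: max_card.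
move=> [[x1 y1] a1] [[x2 y2] a2]; rewrite !inE.
case/andP=> /and3P[_ /eqP xu /eqP yu] _ /andP[/and3P[_ /eqP xu' /eqP yu'] _] e.
rewrite /= in xu yu xu' yu' e; rewrite e in xu yu.
by congr (_, _, _) => //; apply: val_inj => /=; lia.
Qed.

(** What shortcuts can still save from layer [t] on. It serves as a potential, so a walk need not be
    compared with the set of shortcuts it takes. *)
Definition remaining p t := \sum_(e in H | used p e && (t <= layer e.1)) span e.

Lemma remaining_mono p t t' : t <= t' -> remaining p t' <= remaining p t.
Proof.
move=> le_tt'; rewrite /remaining.
rewrite [X in _ <= X](bigID (fun e => t' <= layer e.1)) /=.
apply: leq_trans (leq_addr _ _); apply: eq_leq; apply: eq_bigl => e.
by case: leqP => [le|]; rewrite ?andbF ?andbT // (leq_trans le_tt' le) andbT.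
Qed.

Lemma remaining_step p u v : (u, v) \in H -> used p (u, v) -> layer u < layer v ->
  span (u, v) + remaining p (layer v) <= remaining p (layer u).
Proof.
move=> uvH uvp lt_uv; rewrite [X in _ <= X](bigD1 (u, v)) /= ?uvH ?uvp ?leqnn //.
rewrite leq_add2l /remaining.
rewrite [X in _ <= X](bigID (fun e => layer v <= layer e.1)) /=.
apply: leq_trans (leq_addr _ _); apply: eq_leq; apply: eq_bigl => e.
case: leqP => [le|]; rewrite ?andbF ?andbT //.
rewrite (leq_trans (ltnW lt_uv) le) andbT.
have -> : e != (u, v) by apply/eqP => eE; rewrite eE /= in le; lia.
by rewrite andbT.
Qed.

(** Each edge raises layer plus [remaining] by at most one: a graph edge climbs one layer, and a
    shortcut pays its span out of [remaining]. *)
Lemma walk_size p u q : path (edge GH) u q -> on_line p u ->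
  on_line p (last u q) ->
  layer (last u q) + remaining p (layer (last u q)) <=
    layer u + remaining p (layer u) + size q.
Proof.
elim: q u => [|v q IHq] u /=; first by rewrite addn0.
case/andP=> uv vq pu pq.
have uvc := convex_step_GH p.2 uv.
have pv := on_line_between uvc (convex_step_path p.2 vq) pu pq.
have {}IHq := IHq v vq pv pq.
suff step : layer v + remaining p (layer v) <=
    (layer u + remaining p (layer u)).+1.
  by apply: leq_trans IHq _; rewrite addnS -addSn leq_add2r.
have [le_uv _ _] := uvc; have mono := remaining_mono p le_uv.
move: uv; rewrite /GH /edge /= inE => /orP[|uvH].
  by rewrite inE /= => /andP[/eqP luv _]; rewrite luv in mono *; lia.
have [lt_uv|le_vu] := ltnP (layer u) (layer v).
  have := remaining_step uvH (introT andP (conj pu pv)) lt_uv.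
  by rewrite /span /=; lia.
(* The closure is reflexive, so [H] may contain loops. *)
by have -> : layer v = layer u by lia.
Qed.

(** The successor is there because [m * k] layers are only [m * k - 1] edges apart. *)
Lemma line_le_diameter p :
  m * k <= (diameter GH).+1 + \sum_(e in H | used p e) span e.
Proof.
have mk_gt0 : 0 < m * k by rewrite muln_gt0 m_gt0.
set s := line_vertex p 0; set t := line_vertex p (m * k).-1.
have st : (s, t) \in tclosure GH.
  exact: subsetP (tclosure_setU _ _) _ (line_tclosure p).
have [/existsP[q /andP[GHq /eqP qt]] _] := distP st.
have lt_mk : (m * k).-1 < m * k by lia.
have [ls _ _] := line_vertexK p mk_gt0.
have [lt _ _] := line_vertexK p lt_mk.
have d_le : dist GH s t <= diameter GH.
  exact: (@leq_bigmax_cond _ _ (fun uv => dist GH uv.1 uv.2) (s, t)).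
have rem0 : remaining p 0 = \sum_(e in H | used p e) span e.
  by apply: eq_bigl => e; rewrite andbT.
have := walk_size GHq (on_line_vertex p mk_gt0).
rewrite qt on_line_vertex // ls lt size_tuple rem0 => /(_ isT) le_walk.
by move: (\sum_(e in H | _) _) le_walk => S; lia.
Qed.

Lemma diameter_lower_bound :
  m ^ 6 * (m * k) <= m ^ 6 * (diameter GH).+1 + #|H| * (m * k).
Proof.
have card_line : #|{: line}| = m ^ 6.
  by rewrite /line !card_prod !card_ord -expnD -expnSr.
have : \sum_(p : line) m * k <=
    \sum_(p : line) ((diameter GH).+1 + \sum_(e in H | used p e) span e).
  by apply: leq_sum => p _; apply: line_le_diameter.
rewrite big_split /= !sum_nat_const !card_line => /leq_trans-> //.
rewrite leq_add2l (exchange_big_dep (mem H)) //=; last first.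
  by move=> p e _ /andP[].
rewrite -sum_nat_const; apply: leq_sum => e eH.
apply: leq_trans (used_span_le e); apply: eq_leq; apply: eq_bigl => p.
by rewrite eH.
Qed.

End Shortcuts.

End ParabolaGraph.

(** * Choice of the parameters *)

Lemma hard_digraph (n m k : nat) : 0 < m -> 0 < k ->
  m * k * ((m ^ 2 + m.-1 ^ 2) * (m ^ 3 + m.-1 ^ 3)) <= n ->
  exists G : digraph 'I_n, forall H : digraph 'I_n, H \subset tclosure G ->
    m ^ 6 * (m * k) <= m ^ 6 * (diameter (G :|: H)).+1 + #|H| * (m * k).
Proof.
case: n => [|n] m_gt0 k_gt0 room.
  by move: room; rewrite leqNgt !muln_gt0 !addn_gt0 !expn_gt0 m_gt0 k_gt0.
exists (parabola_graph n m k) => H; exact: diameter_lower_bound.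
Qed.

Lemma scale_exists (n D : nat) : D < n -> n <= D ^ 6 ->
  exists m, [/\ 0 < m, n < 32 * D * m.+1 ^ 5 &
    exists k, [/\ 0 < k,
      m * k * ((m ^ 2 + m.-1 ^ 2) * (m ^ 3 + m.-1 ^ 3)) <= n &
      forall d h : nat, m ^ 6 * (m * k) <= m ^ 6 * d.+1 + h * (m * k) ->
        2 * h < m ^ 6 -> D <= d]].
Proof.
move=> lt_Dn le_nD.
have D_gt0 : 0 < D by case: D lt_Dn le_nD => // ; case: n.
have [small|large] := ltnP n (32 * D).
  (* m = 1: the graph is a path on n vertices, and H must be empty. *)
  exists 1; split=> //; first by lia.
  exists n; split; [by lia | by lia |].
  move=> d h; rewrite exp1n !mul1n => dh h_lt.
  have h0 : h = 0 by case: h h_lt {dh}.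
  by move: dh; rewrite h0 mul0n addn0 => /(leq_trans lt_Dn).
(* 32 = 8 * 2 * 2, from [m * k <= 8 * D], [width <= 2 * m ^ 2] and [height <= 2 * m ^ 3]. *)
pose P m := 32 * D * m ^ 5 <= n.
have P_ub m : P m -> m <= n.
  case: m => // m; rewrite /P expnS mulnCA => Pm; apply: leq_trans Pm.
  by rewrite leq_pmulr // !muln_gt0 D_gt0.
have P1 : exists m, P m by exists 1; rewrite /P exp1n muln1.
have [m Pm m_max] := ex_maxnP P1 P_ub.
have m_gt0 : 0 < m by apply: m_max; rewrite /P exp1n muln1.
exists m; split=> //.
  by rewrite ltnNge; apply/negP => /m_max; rewrite ltnn.
(* Here [n <= D ^ 6] enters; it keeps [m * k] below [8 * D] when [k] is rounded up. *)
have le_mD : m <= D.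
  rewrite -(@leq_exp2r _ _ 5) // -(leq_pmul2l D_gt0) -expnS.
  apply: leq_trans le_nD; apply: leq_trans Pm.
  by rewrite leq_mul2r; apply/orP; right; lia.
exists (4 * D %/ m).+1.
have lo : 4 * D < m * (4 * D %/ m).+1 by rewrite [m * _]mulnC ltn_ceil.
have hi : m * (4 * D %/ m).+1 <= 8 * D.
  by rewrite mulnS [m * _]mulnC; have := leq_trunc_div (4 * D) m; lia.
split=> //.
  apply: leq_trans Pm; apply: (@leq_trans (8 * D * (2 * m ^ 2 * (2 * m ^ 3)))).
    have p2 : m.-1 ^ 2 <= m ^ 2 by rewrite leq_exp2r // leq_pred.
    have p3 : m.-1 ^ 3 <= m ^ 3 by rewrite leq_exp2r // leq_pred.
    by apply: leq_mul => //; apply: leq_mul; lia.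
  by rewrite (_ : m ^ 5 = m ^ 2 * m ^ 3) -?expnD //; lia.
move=> d h; move: (m * _.+1) lo hi => M lo hi dh hm.
rewrite leqNgt; apply/negP => lt_dD.
(* Shortcuts save less than half of [m ^ 6 * M], so [M < 2 * d.+1], against
   [4 * d.+1 <= 4 * D < M]. *)
have : 2 * h * M < m ^ 6 * M by rewrite ltn_pmul2r //; lia.
have : m ^ 6 * (4 * d.+1) <= m ^ 6 * M by rewrite leq_mul2l; lia.
by lia.
Qed.

(** * Real exponents and the asymptotic form *)

Import Order.TTheory GRing.Theory Num.Theory.
Local Open Scope ring_scope.

Lemma powR_natX (R : realType) (x : R) (p q : nat) : (0 < q)%N -> 0 <= x ->
  (x `^ (p%:R / q%:R)) ^+ q = x ^+ p.
Proof.
move=> q_gt0 x_ge0; rewrite -powR_mulrn ?powR_ge0 // -powRrM mulfVK ?powR_mulrn //.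
by rewrite pnatr_eq0 -lt0n.
Qed.

Lemma le_exp6 (R : realType) (n D : nat) :
  n%:R `^ (1 / 6) <= D%:R :> R -> (n <= D ^ 6)%N.
Proof.
move=> nD; rewrite -(ler_nat R) natrX -[leLHS]expr1.
by rewrite -(@powR_natX _ _ 1 6) ?lerXn2r ?nnegrE ?powR_ge0.
Qed.

(** As m + 1 <= 2 m, n / D < 2^10 m^5; the power 6/5 turns this into 2^12 m^6. Fifth powers are
    compared to avoid real exponents. *)
Lemma ratio_bound (R : realType) (n D m : nat) : (0 < D)%N -> (0 < m)%N ->
  (n < 32 * D * m.+1 ^ 5)%N ->
  (n%:R / D%:R : R) `^ (6 / 5) < 2 ^+ 12 * m%:R ^+ 6.
Proof.
move=> D_gt0 m_gt0 lt_n; have D0 : 0 < D%:R :> R by rewrite ltr0n.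
have nD0 : 0 <= n%:R / D%:R :> R by rewrite divr_ge0.
rewrite -(@ltr_pXn2r _ 5) ?nnegrE ?powR_ge0 ?mulr_ge0 ?exprn_ge0 //.
have -> : (2 ^+ 12 * m%:R ^+ 6) ^+ 5 = (2 ^+ 10 * m%:R ^+ 5) ^+ 6 :> R.
  by rewrite [LHS]exprMn [RHS]exprMn -!exprM.
rewrite powR_natX // ltr_pXn2r ?nnegrE ?nD0 ?mulr_ge0 ?exprn_ge0 //.
rewrite ltr_pdivrMr // -!natrX -!natrM ltr_nat.
apply: leq_trans lt_n _.
have : (m.+1 ^ 5 <= (2 * m) ^ 5)%N by rewrite leq_exp2r //; lia.
by rewrite expnMn; nia.
Qed.

Lemma powR_ratio_succ (R : realType) (n D : nat) : (0 < D)%N ->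
  (n%:R / D%:R : R) `^ (6 / 5) <= 4 * (n%:R / D.+1%:R) `^ (6 / 5).
Proof.
move=> D_gt0; have D0 : 0 < D%:R :> R by rewrite ltr0n.
have -> : 4 = 2 `^ 2 :> R by rewrite powR_mulrn // -natrX.
have le2 : 2 `^ (6 / 5) <= 2 `^ 2 :> R.
  by apply: ler_powR; rewrite ?ler1n // ler_pdivrMr // -natrM ler_nat.
apply: le_trans (ler_wpM2r (powR_ge0 _ _) le2).
rewrite -powRM ?divr_ge0 //; apply: ge0_ler_powR; rewrite ?nnegrE ?mulr_ge0 ?invr_ge0 ?ler0n //.
rewrite mulrCA ler_wpM2l // ler_pdivlMr ?ltr0n // mulrC ler_pdivrMr //.
by rewrite -natrM ler_nat; lia.
Qed.

(** An n-vertex digraph with n > 0 has diameter at most n - 1, so empty [H] would refute the claims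
    for [D >= n] and [D.+1 >= n] respectively. *)
Theorem theorem1p3 (R : realType) :
  (exists2 c : R, 0 < c &
     forall n D : nat, n%:R `^ (1 / 6) <= D%:R :> R -> (D < n)%N ->
     exists G : digraph 'I_n, forall H : digraph 'I_n,
       H \subset tclosure G ->
       #|H|%:R <= c * (n%:R / D%:R) `^ (6 / 5) ->
       ~ (diameter (G :|: H) < D)%N)
  /\
  (exists2 c : R, 0 < c &
     forall n D : nat, n%:R `^ (1 / 6) <= D%:R :> R -> (D.+1 < n)%N ->
     c * (n%:R / D%:R) `^ (6 / 5) <= (shortcut_number n D)%:R).
Proof.
have hard : forall n D : nat, n%:R `^ (1 / 6) <= D%:R :> R -> (D < n)%N ->
     exists G : digraph 'I_n, forall H : digraph 'I_n,
       H \subset tclosure G ->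
       #|H|%:R <= (2 ^+ 13)^-1 * (n%:R / D%:R : R) `^ (6 / 5) ->
       ~ (diameter (G :|: H) < D)%N.
  move=> n D /le_exp6 le_nD lt_Dn.
  have D_gt0 : (0 < D)%N by case: D lt_Dn le_nD => //; case: n.
  have [m [m_gt0 n_lt [k [k_gt0 room conclude]]]] := scale_exists lt_Dn le_nD.
  have [G G_hard] := hard_digraph m_gt0 k_gt0 room.
  exists G => H HG cardH; apply/negP; rewrite -leqNgt.
  (* 2^13 is the 2^12 of [ratio_bound] times the 2 in [2 * h < m ^ 6]. *)
  apply: conclude (G_hard H HG) _; rewrite -(ltr_nat R) natrM natrX.
  have := ratio_bound R D_gt0 m_gt0 n_lt.
  move: cardH; rewrite ler_pdivlMl ?exprn_gt0 // => le1 lt1.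
  have := le_lt_trans le1 lt1.
  by rewrite (exprSr 2 12) -mulrA ltr_pM2l ?exprn_gt0.
split; first by exists (2 ^+ 13)^-1; rewrite ?invr_gt0 ?exprn_gt0.
exists ((2 ^+ 13)^-1 / 4); first by rewrite divr_gt0 ?invr_gt0 ?exprn_gt0.
move=> n D nD lt_Dn; have le_nD := le_exp6 nD.
have D_gt0 : (0 < D)%N by case: D lt_Dn le_nD {nD} => //; case: n.
have [s_ok _] := leastP (shortcuts_suffice_ex n D_gt0).
have nD1 : n%:R `^ (1 / 6) <= D.+1%:R :> R by rewrite (le_trans nD) ?ler_nat.
(* Diameter at most [D] means below [D.+1]; passing to [D.+1] costs the factor 4. *)
have [G G_hard] := hard n D.+1 nD1 lt_Dn.
rewrite leNgt; apply/negP => lt_s.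
have /forallP/(_ G)/existsP[H /and3P[HG cardH diamH]] := s_ok.
apply: (G_hard H HG _ diamH); apply: le_trans (_ : (shortcut_number n D)%:R <= _).
  by rewrite ler_nat.
apply: ltW (lt_le_trans lt_s _); rewrite -mulrA ler_pM2l ?invr_gt0 ?exprn_gt0 //.
by rewrite ler_pdivrMl //; exact: powR_ratio_succ.
Qed.
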